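(* Let $G$ be an $n$-dimensional integrator system, i.e. a system as described in the context with $A=0$, controlled with the LQG-optimal sampled-data controller structure, and let $R$, $Q$ be the associated noise intensity and state cost matrices. Let $$J_{\mathrm p}=\frac{\mathrm{Tr}(RQ)}{2},\qquad J_{\mathrm e}=\frac{[\mathrm{Tr}(RP)]^2}{4},$$ where $P\succ0$ is the unique positive definite solution of $PRP+\frac12\mathrm{Tr}(RP)P=Q$, be the cost coefficients for periodic sampling and for optimal event-based sampling, respectively. Then the performance ratio $J_{\mathrm{ratio}}:=J_{\mathrm p}/J_{\mathrm e}$ satisfies $$1+\frac2n\le J_{\mathrm{ratio}}<3\qquad\text{if } n\ge2,$$ and $J_{\mathrm{ratio}}=3$ if $n=1$. Furthermore, for each $n\ge 2$ these bounds are tight: equality $J_{\mathrm{ratio}}=1+\frac2n$ holds when the eigenvalues of the matrix $RQ$ are all identical, and $J_{\mathrm{ratio}}$ approaches the upper bound $3$ when all but one eigenvalue of $RQ$ approach zero (i.e. along any sequence of such systems of fixed dimension $n$ for which all but one eigenvalue of $RQ$ tend to $0$ while the remaining eigenvalue stays bounded away from $0$).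
   Context: All matrices are real, $M\succ0$ means symmetric positive definite, and $\mathrm{Tr}$ is the trace. System. $G$ is the continuous-time LTI system $\dot x=Ax+B_ww+B_uu$, $z=C_zx+D_{zu}u$, $y=C_yx+D_{yw}w$ with $x(t)\in\mathbb{R}^n$, $w$ unit-intensity white noise, $u$ the control, $y$ the measurement and $z$ the controlled signal. It satisfies the standard output-feedback $\mathcal H_2$ assumptions: $(A,B_u)$ is stabilizable and $(C_y,A)$ detectable; $D_{zu}$ has full column rank and $D_{yw}$ full row rank (no normalization is assumed); $\begin{bmatrix}A-j\omega I&B_u\\C_z&D_{zu}\end{bmatrix}$ has full column rank and $\begin{bmatrix}A-j\omega I&B_w\\C_y&D_{yw}\end{bmatrix}$ has full row rank for all real $\omega$. The integrator case is $A=0$. Gains and matrices. Let $X,Y$ be the stabilizing solutions of the Riccati equations $$A^\intercal X+XA+C_z^\intercal C_z-F^\intercal(D_{zu}^\intercal D_{zu})F=0,\quad F=-(D_{zu}^\intercal D_{zu})^{-1}(B_u^\intercal X+D_{zu}^\intercal C_z),$$ $$AY+YA^\intercal+B_wB_w^\intercal-L(D_{yw}D_{yw}^\intercal)L^\intercal=0,\quad L=-(YC_y^\intercal+B_wD_{yw}^\intercal)(D_{yw}D_{yw}^\intercal)^{-1}.$$ Put $R=LD_{yw}D_{yw}^\intercal L^\intercal$ and $Q=F^\intercal D_{zu}^\intercal D_{zu}F$. For $A=0$ these are $R=B_wB_w^\intercal\succ0$ and $Q=C_z^\intercal C_z\succ0$. Controller structure and costs. The LQG-optimal sampled-data controller consists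 of a sensor-side Kalman–Bucy filter $\dot x_s=Ax_s+B_uu-L(y-C_yx_s)$ and an actuator-side simulation $\dot x_a=(A+B_uF)x_a$, $u=Fx_a$, with $x_a(t_i)=x_s(t_i)$ at the sampling times $t_i$. The LQG cost $\limsup_{T\to\infty}\frac1T\mathbb E\int_0^Tz^\intercal z\,dt$ obtained with it equals the continuous-time LQG-optimal cost plus the sampling degradation $J_H=\limsup_{T\to\infty}\frac1T\mathbb E\int_0^Tx_H^\intercal Qx_H\,dt$, where $x_H=x_a-x_s$ obeys the linear reset system $\dot x_H=Ax_H+\epsilon$, $x_H(t_i)=0$, driven by white noise $\epsilon$ of intensity $R$. The average sampling rate is $f=\limsup_{T\to\infty}\frac1T\mathbb E\sum_i1_{t_i\le T}$ and the average sampling period is $h_{\mathrm{avg}}=1/f$. Optimal event-based sampling means a sampling scheme triggered by $x_H$ that minimizes $J_H+\rho f$ for a per-sample cost $\rho$. For $A=0$, $J_H=J_{\mathrm p}h_{\mathrm{avg}}$ under periodic sampling with period $h_{\mathrm{avg}}$, and $J_H=J_{\mathrm e}h_{\mathrm{avg}}$ under optimal event-based sampling, with $J_{\mathrm p}$ and $J_{\mathrm e}$ given by the formulas in the claim. *)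

(* Defs.v *)
From mathcomp Require Import all_boot all_order all_algebra.
From mathcomp Require Import complex.
From mathcomp Require Import all_classical all_reals all_analysis.

Set Implicit Arguments.
Unset Strict Implicit.
Unset Printing Implicit Defensive.

Import Order.TTheory GRing.Theory Num.Theory.
Import numFieldNormedType.Exports.

Local Open Scope classical_set_scope.
Local Open Scope ring_scope.

Definition posdef (K : realType) (n : nat) (M : 'M[K]_n) : Prop :=
  M^T = M /\ forall v : 'cV[K]_n, v != 0 -> 0 < (v^T *m M *m v) 0 0.

Definition toC (K : realType) (m n : nat) (M : 'M[K]_(m, n)) : 'M[K[i]]_(m, n) :=
  map_mx (real_complex K) M.

Definition hurwitz (K : realType) (n : nat) (M : 'M[K]_n) : Prop :=
  forall l : K[i], eigenvalue (toC M) l -> complex.Re l < 0.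

(* [e] lists the complex eigenvalues of [M] with algebraic multiplicity. *)
Definition is_spectrum (K : realType) (n : nat) (M : 'M[K]_n)
    (e : 'I_n -> K[i]) : Prop :=
  char_poly (toC M) = \prod_(i < n) ('X - (e i)%:P).

(* x' = A x + Bw w + Bu u,  z = Cz x + Dzu u,  y = Cy x + Dyw w.
   Only the state dimension is a parameter, so that the dimensions of the
   signals w, u, z, y may vary along a sequence of systems. *)
Record lti (K : realType) (n : nat) := Lti {
  dim_w : nat;
  dim_u : nat;
  dim_z : nat;
  dim_y : nat;
  A_ : 'M[K]_n;
  Bw : 'M[K]_(n, dim_w);
  Bu : 'M[K]_(n, dim_u);
  Cz : 'M[K]_(dim_z, n);
  Dzu : 'M[K]_(dim_z, dim_u);
  Cy : 'M[K]_(dim_y, n);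
  Dyw : 'M[K]_(dim_y, dim_w)
}.

Section H2.
Context (K : realType) (n : nat).
Implicit Types G : lti K n.

Definition stabilizable (m : nat) (A : 'M[K]_n) (B : 'M[K]_(n, m)) : Prop :=
  exists F : 'M[K]_(m, n), hurwitz (A + B *m F).

Definition detectable (p : nat) (C : 'M[K]_(p, n)) (A : 'M[K]_n) : Prop :=
  exists L : 'M[K]_(n, p), hurwitz (A + L *m C).

Definition freq_mx (A : 'M[K]_n) (omega : K) : 'M[K[i]]_n :=
  toC A - (Complex 0 omega)%:M.

Definition h2_assumptions G : Prop :=
  [/\ stabilizable (A_ G) (Bu G) /\ detectable (Cy G) (A_ G),
      \rank (Dzu G) = dim_u G,
      \rank (Dyw G) = dim_y G,
      forall omega : K,
        \rank (block_mx (freq_mx (A_ G) omega) (toC (Bu G))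
                        (toC (Cz G)) (toC (Dzu G))) = (n + dim_u G)%N &
      forall omega : K,
        \rank (block_mx (freq_mx (A_ G) omega) (toC (Bw G))
                        (toC (Cy G)) (toC (Dyw G))) = (n + dim_y G)%N].

Definition gainF G (X : 'M[K]_n) : 'M[K]_(dim_u G, n) :=
  - (invmx ((Dzu G)^T *m Dzu G) *m ((Bu G)^T *m X + (Dzu G)^T *m Cz G)).

Definition gainL G (Y : 'M[K]_n) : 'M[K]_(n, dim_y G) :=
  - ((Y *m (Cy G)^T + Bw G *m (Dyw G)^T) *m invmx (Dyw G *m (Dyw G)^T)).

Definition state_cost G (X : 'M[K]_n) : 'M[K]_n :=
  (gainF G X)^T *m ((Dzu G)^T *m Dzu G) *m gainF G X.

Definition noise_intensity G (Y : 'M[K]_n) : 'M[K]_n :=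
  gainL G Y *m (Dyw G *m (Dyw G)^T) *m (gainL G Y)^T.

Definition stabilizing_X G (X : 'M[K]_n) : Prop :=
  [/\ X^T = X,
      (A_ G)^T *m X + X *m A_ G + (Cz G)^T *m Cz G - state_cost G X = 0 &
      hurwitz (A_ G + Bu G *m gainF G X)].

Definition stabilizing_Y G (Y : 'M[K]_n) : Prop :=
  [/\ Y^T = Y,
      A_ G *m Y + Y *m (A_ G)^T + Bw G *m (Bw G)^T - noise_intensity G Y = 0 &
      hurwitz (A_ G + gainL G Y *m Cy G)].

Definition lqg_integrator G (X Y : 'M[K]_n) : Prop :=
  [/\ h2_assumptions G, A_ G = 0, stabilizing_X G X & stabilizing_Y G Y].

Implicit Types R Q P : 'M[K]_n.

Definition event_solution R Q P : Prop :=
  posdef P /\ P *m R *m P + (2^-1 * \tr (R *m P)) *: P = Q.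

(* The positive definite solution; the default value 0 is irrelevant as soon
   as a unique such solution exists. *)
Definition event_mx R Q : 'M[K]_n := xget 0 [set P | event_solution R Q P].

Definition Jp R Q : K := \tr (R *m Q) / 2.

Definition Je R Q : K := (\tr (R *m event_mx R Q)) ^+ 2 / 4.

Definition Jratio G (X Y : 'M[K]_n) : K :=
  Jp (noise_intensity G Y) (state_cost G X) /
  Je (noise_intensity G Y) (state_cost G X).

End H2.

(* Main.v *)
Require Import Defs.
From mathcomp Require Import all_boot all_order all_algebra.
From mathcomp Require Import complex.
From mathcomp Require Import perm ring lra.
From mathcomp Require Import all_classical all_reals all_analysis.

Set Implicit Arguments.
Unset Strict Implicit.
Unset Printing Implicit Defensive.

Import Order.TTheory GRing.Theory Num.Theory.
Import numFieldNormedType.Exports.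

Local Open Scope classical_set_scope.
Local Open Scope ring_scope.

(* For an integrator, A = 0 turns the Riccati equations into Q = Cz^T Cz and
   R = Bw Bw^T, and the frequency conditions at omega = 0 make both positive
   definite. Choosing an invertible B with R = B B^T and B^T Q B diagonal, the
   substitution P |-> B^T P B reduces the matrix equation for P to the scalar
   equations p_i^2 + (1/2) s p_i = d_i with s = \sum_j p_j, where the d_i are
   the eigenvalues of R Q. Each p_i decreases in s, so s, and with it P, is
   unique; since \tr (R P) = s, the ratio is 1 + 2 (\sum_i p_i^2) / s^2. The
   bounds are then Cauchy-Schwarz and \sum_i p_i^2 < s^2, and the gap to 3 is
   at most 12 (\sum_(i <> i0) d_i) / d_i0. *)

(** * Spectral theorem for real symmetric matrices *)

Section RealSpectral.
Context (K : realType).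

(** An eigenvalue [l] exists over the algebraically closed [K[i]], with a row eigenvector [v].
    Evaluating [v *m toC S *m vs], where [vs] is the conjugate transpose of [v], from the left and
    from the right gives [l] and its conjugate times the nonzero squared norm of [v]. So [l] is
    real, and the characteristic polynomial carries it back to [K]. *)
Lemma sym_eigenvalue_real (n : nat) (S : 'M[K]_n) : (0 < n)%N -> S^T = S ->
  exists a, eigenvalue S a.
Proof.
move=> n_gt0 symS.
have [l /eigenvalueP[v vS v0]] := eigenvalue_closed (toC S) n_gt0.
suff /complex_realP[a la] : l \is Num.real.
  have : eigenvalue (toC S) (real_complex K a).
    by apply/eigenvalueP; exists v => //; rewrite vS la.
  rewrite !eigenvalue_root_char /toC -map_char_poly fmorph_root => ?.
  by exists a; rewrite eigenvalue_root_char.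
have SC : map_mx Num.conj (toC S) = toC S.
  by apply/matrixP => i j; rewrite !mxE; apply/CrealP/complex_realP; exists (S i j).
pose vs := map_mx Num.conj v^T.
have vvE : (v *m vs) 0 0 = \sum_i `|v 0 i| ^+ 2.
  by rewrite mxE; apply: eq_bigr => i _; rewrite !mxE normCK.
have vv0 : (v *m vs) 0 0 != 0.
  apply: contra_neq v0 => /eqP; rewrite vvE psumr_eq0; last first.
    by move=> i _; exact: exprn_ge0.
  move=> /allP h; apply/rowP => i; rewrite !mxE; apply/eqP.
  by have := h i (mem_index_enum _); rewrite sqrf_eq0 normr_eq0.
have e1 : v *m toC S *m vs = l *: (v *m vs) by rewrite vS scalemxAl.
have e2 : v *m toC S *m vs = (Num.conj l) *: (v *m vs).
  have : toC S *m vs = Num.conj l *: vs.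
    rewrite -[in LHS]SC /vs -[toC S]trmxK /toC map_trmx symS -/(toC S).
    by rewrite -map_mxM -trmx_mul vS linearZ /= map_mxZ.
  by rewrite -mulmxA => ->; rewrite scalemxAr.
apply/CrealP.
move/matrixP: (etrans (esym e2) e1) => /(_ 0 0).
by rewrite [LHS]mxE [RHS]mxE => /(mulIf vv0).
Qed.

Lemma row_sqr_sum (n : nat) (v : 'rV[K]_n) :
  (v *m v^T) 0 0 = \sum_i v 0 i ^+ 2.
Proof. by rewrite mxE; apply: eq_bigr => i _; rewrite mxE expr2. Qed.

Lemma row_sqr_eq0 (n : nat) (v : 'rV[K]_n) : (v *m v^T) 0 0 = 0 -> v = 0.
Proof.
move/eqP; rewrite row_sqr_sum psumr_eq0; last by move=> i _; exact: sqr_ge0.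
move=> /allP h; apply/rowP => i; rewrite mxE; apply/eqP.
by have := h i (mem_index_enum _); rewrite sqrf_eq0.
Qed.

(** The reflection along [w = v - e], with [e] the first basis vector, exchanges [e] and [v] because
    both have length 1. *)
Lemma householder (n : nat) (v : 'rV[K]_n.+1) : (v *m v^T) 0 0 = 1 ->
  exists H : 'M[K]_n.+1, [/\ H^T = H, H *m H = 1%:M & delta_mx 0 0 *m H = v].
Proof.
move=> v1; pose e : 'rV[K]_n.+1 := delta_mx 0 0; pose w := v - e.
pose s := (w *m w^T) 0 0; pose c := 2 / s.
have ewE : e *m w^T = (v 0 0 - 1)%:M.
  by rewrite [LHS]mx11_scalar -rowE !mxE eqxx.
have sE : s = 2 - v 0 0 *+ 2.
  rewrite /s {1}/w mulmxBl ewE /w linearB /= mulmxBr.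
  have -> : v *m e^T = (v 0 0)%:M.
    apply: trmx_inj; rewrite trmx_mul trmxK tr_scalar_mx.
    by rewrite [LHS]mx11_scalar -rowE !mxE.
  rewrite mxE [X in X + _]mxE v1 mxE.
  by rewrite !mxE eqxx ?mulr1n; ring.
have wwE : w *m w^T = s%:M by rewrite [LHS]mx11_scalar.
(* If v = e then s = 0, c = 2 / 0 = 0 and the witness is the identity. *)
exists (1%:M - c *: (w^T *m w)); split.
- by rewrite linearB linearZ /= trmx1 trmx_mul trmxK.
- have : (w^T *m w) *m (w^T *m w) = s *: (w^T *m w).
    by rewrite mulmxA -(mulmxA _ w) wwE mul_mx_scalar -scalemxAl.
  have cs : c * c * s = c + c.
    rewrite -mulrA /c; have [->|s0] := eqVneq s 0; first by rewrite invr0; ring.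
    by rewrite divfK //; ring.
  move: (w^T *m w) => A AA.
  rewrite mulmxBl mul1mx mulmxBr mulmx1 -scalemxAl -scalemxAr AA !scalerA cs.
  by apply/matrixP => i j; rewrite !mxE; ring.
- rewrite mulmxBr mulmx1 -scalemxAr mulmxA ewE mul_scalar_mx scalerA.
  have [s0|s0] := eqVneq s 0.
    have w0 : w = 0 by exact: row_sqr_eq0.
    by rewrite w0 scaler0 subr0; apply/esym/eqP; rewrite -subr_eq0 -/w w0.
  suff -> : c * (v 0 0 - 1) = -1 by rewrite scaleN1r opprK /w addrC subrK.
  have -> : v 0 0 - 1 = - (s / 2) by rewrite sE; field.
  by rewrite /c; field.
Qed.

(* Deflation: the reflection that maps the first basis vector to a unit
   eigenvector brings S to the form block_mx a 0 0 S'. *)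
Theorem real_spectral (n : nat) (S : 'M[K]_n) : S^T = S ->
  exists (U : 'M[K]_n) (d : 'rV[K]_n),
    U *m U^T = 1%:M /\ U *m S *m U^T = diag_mx d.
Proof.
elim: n S => [|n IHn] S symS.
  by exists 1%:M, 0; split; apply/matrixP; case.
have [a /eigenvalueP[u uS u0]] := sym_eigenvalue_real (ltn0Sn n) symS.
pose r := Num.sqrt ((u *m u^T) 0 0).
have uu0 : 0 < (u *m u^T) 0 0.
  rewrite lt_neqAle eq_sym row_sqr_sum sumr_ge0 ?andbT; last by move=> *; exact: sqr_ge0.
  by rewrite -row_sqr_sum; apply: contra_neq u0; exact: row_sqr_eq0.
have r0 : r != 0 by rewrite gt_eqF // sqrtr_gt0.
pose v := r^-1 *: u.
have v1 : (v *m v^T) 0 0 = 1.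
  rewrite /v linearZ /= -scalemxAl -scalemxAr 2!mxE mulrA -invfM -expr2.
  by rewrite sqr_sqrtr ?ltW // mulVf // gt_eqF.
have vS : v *m S = a *: v by rewrite -scalemxAl uS !scalerA mulrC.
have [H [symH HH Hv]] := householder v1.
pose M : 'M[K]_(1 + n) := H *m S *m H.
have symM : M^T = M by rewrite !trmx_mul symH symS mulmxA.
have rowM : (delta_mx 0 0 : 'rV_n.+1) *m M = a *: delta_mx 0 0.
  by rewrite /M !mulmxA Hv vS -Hv -scalemxAl -mulmxA HH mulmx1.
have defM : H *m S *m H = M by [].
clearbody M.
have M0 j : M 0 j = a * (j == 0)%:R.
  by move/matrixP: rowM => /(_ 0 j); rewrite -rowE !mxE eqxx.
(* The first row is known from [M0]; symmetry of [M] gives the first column. *)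
have ME : M = block_mx a%:M 0 0 (drsubmx M).
  rewrite -[LHS]submxK; congr block_mx.
  - by rewrite [LHS]mx11_scalar !mxE lshift0 M0 eqxx mulr1.
  - by apply/matrixP => i j; rewrite !mxE (ord1 i) lshift0 M0 mulr0.
  - by apply/matrixP => i j; rewrite !mxE -symM mxE (ord1 j) lshift0 M0 mulr0.
have symN : (drsubmx M)^T = drsubmx M by rewrite trmx_drsub symM.
have [V [d [VV Vd]]] := IHn _ symN.
pose W : 'M[K]_(1 + n) := block_mx 1%:M 0 0 V.
have WT : W^T = block_mx 1%:M 0 0 V^T by rewrite tr_block_mx !trmx0 trmx1.
have WW : W *m W^T = 1%:M.
  rewrite WT mulmx_block !mulmx0 !mul0mx !mulmx1 VV !addr0 !add0r.
  by rewrite -scalar_mx_block.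
have WMW : W *m M *m W^T = diag_mx (row_mx a%:M d).
  rewrite WT [in LHS]ME !mulmx_block !mulmx0 !mul0mx !mulmx1 !mul1mx.
  rewrite !addr0 !add0r !mul0mx Vd diag_mx_row; congr block_mx.
  by rewrite [RHS]mx11_scalar !mxE eqxx.
exists (W *m H), (row_mx a%:M d); split.
  by rewrite trmx_mul symH mulmxA -(mulmxA W) HH mulmx1.
by rewrite -WMW trmx_mul symH -defM !mulmxA.
Qed.

End RealSpectral.

(** * The coupled scalar equations *)

Section ScalarEquations.
Context (K : realType).

(** Decouple by treating the sum as a parameter [t]: each equation then has the positive root
    [r t i], and the intermediate value theorem yields a [t] equal to the sum of these roots. *)
Lemma event_scalar_exists (n : nat) (d : 'I_n -> K) : (forall i, 0 < d i) ->
  exists p : 'I_n -> K, (forall i, 0 < p i) /\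
    forall i, p i ^+ 2 + 2^-1 * (\sum_j p j) * p i = d i.
Proof.
move=> d0.
pose r (t : K) i := Num.sqrt (t ^+ 2 / 16 + d i) - t / 4.
have rE t i : 0 <= t -> 0 < r t i /\ r t i ^+ 2 + 2^-1 * t * r t i = d i.
  move=> t0; have d0i := d0 i.
  have a0 : 0 < t ^+ 2 / 16 + d i by rewrite ltr_wpDl // divr_ge0 // sqr_ge0.
  have sE : Num.sqrt (t ^+ 2 / 16 + d i) ^+ 2 = t ^+ 2 / 16 + d i.
    by rewrite sqr_sqrtr // ltW.
  have s0 : 0 < Num.sqrt (t ^+ 2 / 16 + d i) by rewrite sqrtr_gt0.
  rewrite /r; move: (Num.sqrt _) sE s0 => s sE s0; split; last by nra.
  by rewrite subr_gt0 ltNge; apply/negP => st; nra.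
have rC i : continuous (r^~ i).
  move=> x; apply: cvgB; last by apply: cvgMl; exact: cvg_id.
  apply: (@continuous_comp _ _ _ (fun t : K => t ^+ 2 / 16 + d i) Num.sqrt).
    by apply: cvgD; [apply: cvgMl; exact: exprn_continuous|exact: cvg_cst].
  exact: sqrt_continuous.
(* For nonnegative [t] the root [r t i] is at most the square root of [d i], so at [t = T] the sum
   of the roots no longer exceeds [t]. *)
pose T := \sum_i Num.sqrt (d i).
have T0 : 0 <= T by apply: sumr_ge0 => i _; exact: sqrtr_ge0.
have [t /[!in_itv]/= /andP[t0 tT] tE] :
    exists2 t, t \in `[0, T] & (\sum_i r t i) - t = 0.
  apply: IVT => //.
    apply: continuous_subspaceT => x; apply: cvgB; last exact: cvg_id.
    by apply: cvg_big => // [|i _]; [exact: add_continuous|exact: rC].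
  have f0 : 0 <= \sum_i r 0 i - 0.
    by rewrite subr0; apply: sumr_ge0 => i _; case: (rE 0 i (lexx _)) => /ltW.
  have fT : \sum_i r T i - T <= 0.
    rewrite subr_le0; apply: ler_sum => i _; case: (rE T i T0) => r0 rT.
    rewrite -(@ler_pXn2r _ 2) ?nnegrE ?sqrtr_ge0 ?(ltW r0) //.
    rewrite sqr_sqrtr ?(ltW (d0 i)) //.
    by rewrite -rT lerDl mulr_ge0 ?mulr_ge0 ?invr_ge0 // ltW.
  by rewrite ge_min le_max f0 fT orbT.
move/eqP: tE; rewrite subr_eq0 => /eqP tE.
by exists (r t); rewrite tE; split => i; case: (rE t i t0).
Qed.

(** If the sum of [p] is at most that of [q], then [p i < q i] would make the left side of equation
    [i] strictly smaller than the right side. Hence [q] is at most [p] termwise, which reverses the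
    inequality of the sums. *)
Lemma event_scalar_unique (n : nat) (p q : 'I_n -> K) :
  (forall i, 0 < p i) -> (forall i, 0 < q i) ->
  (forall i, p i ^+ 2 + 2^-1 * (\sum_j p j) * p i =
             q i ^+ 2 + 2^-1 * (\sum_j q j) * q i) ->
  \sum_i p i = \sum_i q i.
Proof.
wlog lepq : p q / \sum_i p i <= \sum_i q i.
  move=> W p0 q0 pq; have [/W->//|/ltW/W->//] := leP (\sum_i p i) (\sum_i q i).
move=> p0 q0 pq; apply/eqP; rewrite eq_le lepq /=.
apply: ler_sum => i _; rewrite leNgt; apply/negP => piq.
have := pq i; have := p0 i; have := q0 i.
have P0 : 0 <= \sum_j p j by apply: sumr_ge0 => j _; exact: ltW.
move: (\sum_j p j) (\sum_j q j) lepq P0 => P Q *; nra.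
Qed.

(** Spectra obtained from different diagonalizations come in unrelated orders; unique factorization
    matches them. *)
Lemma prod_XsubC_perm (F : fieldType) (n : nat) (d e : 'I_n -> F) :
  \prod_(i < n) ('X - (d i)%:P) = \prod_(i < n) ('X - (e i)%:P) ->
  exists s : 'S_n, forall i, d i = e (s i).
Proof.
move=> de.
have : perm_eq [tuple d i | i < n] [tuple e i | i < n].
  apply: prod_XsubC_eq; rewrite !big_tuple; under eq_bigr do rewrite tnth_mktuple.
  by under [RHS]eq_bigr do rewrite tnth_mktuple.
case/tuple_permP => s /val_inj sE; exists s => i.
by move/(congr1 (fun t => tnth t i)): sE; rewrite !tnth_mktuple.
Qed.

End ScalarEquations.

(** * Positive definite matrices and congruence *)

Section PosDef.
Context (K : realType).

Lemma posdef_col (n m : nat) (M : 'M[K]_n) (X : 'M[K]_(n, m)) (j : 'I_m) :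
  (X^T *m M *m X) j j = ((col j X)^T *m M *m col j X) 0 0.
Proof.
rewrite colE trmx_mul -!mulmxA -colE trmx_delta -rowE !mulmxA !mxE.
by apply: eq_bigr => k _; rewrite !mxE.
Qed.

Lemma posdef_unitmx (n : nat) (M : 'M[K]_n) : posdef M -> M \in unitmx.
Proof.
move=> [symM posM]; rewrite -row_free_unit; apply: inj_row_free => v vM.
apply/eqP/negPn/negP => v0; have := posM v^T; rewrite trmxK vM mul0mx mxE ltxx.
by rewrite -(inj_eq trmx_inj) trmxK trmx0 v0 => /(_ isT).
Qed.

Lemma posdef_congr (n : nat) (M B : 'M[K]_n) :
  B \in unitmx -> posdef M -> posdef (B^T *m M *m B).
Proof.
move=> uB [symM posM]; split; first by rewrite !trmx_mul trmxK symM mulmxA.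
move=> v v0; have := posM (B *m v); rewrite trmx_mul !mulmxA; apply.
by apply: contra_neq v0 => Bv; rewrite -[v](mulKmx uB) Bv mulmx0.
Qed.

Lemma posdef_diagP (n : nat) (d : 'rV[K]_n) :
  posdef (diag_mx d) <-> forall i, 0 < d 0 i.
Proof.
have dE (v : 'cV[K]_n) : (v^T *m diag_mx d *m v) 0 0 = \sum_i d 0 i * v i 0 ^+ 2.
  rewrite -mulmxA mxE; apply: eq_bigr => i _.
  by rewrite mul_diag_mx !mxE; ring.
split=> [[_ posd] i|d0].
  have := posd (delta_mx i 0); rewrite dE (bigD1 i) //= big1 => [|j ji].
    rewrite mxE !eqxx mulr1n expr1n mulr1 addr0; apply.
    by apply/eqP => /matrixP/(_ i 0)/eqP; rewrite !mxE !eqxx oner_eq0.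
  by rewrite mxE (negbTE ji) mulr0n expr0n mulr0.
split=> [|v v0]; first exact: tr_diag_mx.
rewrite dE lt_neqAle sumr_ge0 ?andbT => [|i _]; last first.
  by rewrite mulr_ge0 ?sqr_ge0 // ltW.
rewrite eq_sym; apply: contra_neq v0 => /eqP; rewrite psumr_eq0 => [/allP h|i _].
  apply/colP => i; have := h i (mem_index_enum _); rewrite mulf_eq0 gt_eqF //=.
  by rewrite sqrf_eq0 mxE => /eqP.
by rewrite mulr_ge0 ?sqr_ge0 // ltW.
Qed.

Lemma posdef_mxtrace_ge0 (n m : nat) (M : 'M[K]_n) (X : 'M[K]_(n, m)) :
  posdef M -> 0 <= \tr (X^T *m M *m X).
Proof.
move=> [_ posM]; apply: sumr_ge0 => j _; rewrite posdef_col.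
have [->|c0] := eqVneq (col j X) 0; last exact/ltW/posM.
by rewrite mulmx0 mxE.
Qed.

Lemma posdef_mxtrace_eq0 (n m : nat) (M : 'M[K]_n) (X : 'M[K]_(n, m)) :
  posdef M -> \tr (X^T *m M *m X) = 0 -> X = 0.
Proof.
move=> pM /eqP; rewrite psumr_eq0 => [/allP h|j _]; last first.
  rewrite posdef_col; have [->|c0] := eqVneq (col j X) 0; last first.
    by case: pM => _ posM; exact/ltW/posM.
  by rewrite mulmx0 mxE.
apply/matrixP => i j; have := h j (mem_index_enum _); rewrite posdef_col => /eqP Xj.
have [/matrixP/(_ i 0)|c0] := eqVneq (col j X) 0; first by rewrite !mxE.
by case: pM => _ /(_ _ c0); rewrite Xj ltxx.
Qed.

(** Diagonalizing [M] and taking square roots of its eigenvalues gives [M = B0 *m B0^T]. This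
    factorization survives multiplying [B0] on the right by an orthogonal matrix, and that freedom
    diagonalizes [B0^T *m N *m B0]. *)
Lemma simultaneous_diag (n : nat) (M N : 'M[K]_n) : posdef M -> N^T = N ->
  exists (B : 'M[K]_n) (d : 'rV[K]_n),
    [/\ B \in unitmx, M = B *m B^T & B^T *m N *m B = diag_mx d].
Proof.
move=> pM symN; have [symM _] := pM.
have [U [r [UU Ur]]] := real_spectral symM.
have UU' : U^T *m U = 1%:M by exact: mulmx1C.
have uU : U^T \in unitmx by rewrite unitmx_tr; case/mulmx1_unit: UU.
have /posdef_diagP r0 : posdef (diag_mx r).
  by rewrite -Ur -{1}[U]trmxK; apply: posdef_congr.
pose B0 := U^T *m diag_mx (map_mx Num.sqrt r).
have B0B0 : B0 *m B0^T = M.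
  rewrite /B0 trmx_mul trmxK tr_diag_mx mulmxA -(mulmxA U^T) mulmx_diag.
  have -> : \row_j (map_mx Num.sqrt r 0 j * map_mx Num.sqrt r 0 j) = r.
    by apply/rowP => j; rewrite !mxE -expr2 sqr_sqrtr // ltW.
  by rewrite -Ur !mulmxA UU' mul1mx -mulmxA UU' mulmx1.
clearbody B0.
have symN0 : (B0^T *m N *m B0)^T = B0^T *m N *m B0.
  by rewrite !trmx_mul trmxK symN mulmxA.
have [V [d [VV Vd]]] := real_spectral symN0.
have BB : M = B0 *m V^T *m (B0 *m V^T)^T.
  by rewrite trmx_mul trmxK mulmxA -(mulmxA B0) (mulmx1C VV) mulmx1 B0B0.
exists (B0 *m V^T), d; split => //.
  by move: (posdef_unitmx pM); rewrite {1}BB unitmx_mul => /andP[].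
by rewrite -Vd trmx_mul trmxK !mulmxA.
Qed.

(* X = P - P' satisfies P X + X P' + t X = 0, so the trace of the product with X
   is a vanishing sum of nonnegative terms. *)
Lemma posdef_root_unique (n : nat) (P P' : 'M[K]_n) (t : K) : 0 <= t ->
  posdef P -> posdef P' -> P *m P + t *: P = P' *m P' + t *: P' -> P = P'.
Proof.
move=> t0 pP pP' PP'; apply/eqP; rewrite -subr_eq0; apply/eqP.
have symX : (P - P')^T = P - P' by rewrite linearB /= pP.1 pP'.1.
(* With the identity as the middle factor, the [t] term is covered by the same trace lemma as the
   other two. *)
have p1 : posdef (1%:M : 'M[K]_n).
  by rewrite -diag_const_mx; apply/posdef_diagP => i; rewrite mxE ltr01.
set X := P - P' in symX *.
have XE : P *m X + X *m P' + t *: X = 0.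
  rewrite /X mulmxBr mulmxBl scalerBr addrACA -addrA addrA.
  move/eqP: PP'; rewrite -subr_eq0 opprD => /eqP <-.
  by apply/matrixP => i j; rewrite !mxE; ring.
have : \tr (X^T *m P *m X) + \tr (X^T *m P' *m X) + t * \tr (X^T *m 1%:M *m X) = 0.
  rewrite symX mulmx1 -mxtraceZ (mxtrace_mulC (X *m P')) -!mxtraceD.
  by rewrite scalemxAr -mulmxA -!mulmxDr XE mulmx0 mxtrace0.
have := posdef_mxtrace_ge0 X pP; have := posdef_mxtrace_ge0 X pP'.
have := mulr_ge0 t0 (posdef_mxtrace_ge0 X p1) => a b c abc.
by apply: (posdef_mxtrace_eq0 pP); apply/eqP; rewrite eq_le c andbT -abc; lra.
Qed.

Lemma char_poly_similar (n : nat) (B C : 'M[K]_n) : B \in unitmx ->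
  char_poly (B *m C *m invmx B) = char_poly C.
Proof.
move=> uB; rewrite /char_poly.
have BB : map_mx polyC B *m map_mx polyC (invmx B) = 1%:M.
  by rewrite -map_mxM mulmxV // map_mx1.
have -> : char_poly_mx (B *m C *m invmx B) =
    map_mx polyC B *m char_poly_mx C *m map_mx polyC (invmx B).
  rewrite /char_poly_mx mulmxBr mulmxBl !map_mxM; congr (_ - _).
  by rewrite mul_mx_scalar -scalemxAl BB scalemx1.
by rewrite !det_mulmx mulrAC -det_mulmx BB det1 mul1r.
Qed.

End PosDef.

(** * The matrix equation for P *)

Section EventSolution.
Context (K : realType) (n : nat).
Implicit Types (R Q P B : 'M[K]_n) (p : 'I_n -> K).

(** Cyclicity of the trace keeps the scalar coefficient unchanged, so the whole equation is
    transported by congruence and [R] becomes the identity. *)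
Lemma event_solution_congr R Q P B : B \in unitmx -> R = B *m B^T ->
  event_solution R Q P <->
  event_solution 1%:M (B^T *m Q *m B) (B^T *m P *m B).
Proof.
move=> uB RE; have uBT : B^T \in unitmx by rewrite unitmx_tr.
have pdE : posdef P <-> posdef (B^T *m P *m B).
  split=> [|pd]; first exact: posdef_congr.
  have uV : invmx B \in unitmx by rewrite unitmx_inv.
  have := posdef_congr uV pd.
  by rewrite trmx_inv !mulmxA mulVmx // mul1mx mulmxK.
rewrite /event_solution mul1mx mulmx1.
have -> : \tr (R *m P) = \tr (B^T *m P *m B).
  by rewrite RE [RHS]mxtrace_mulC mulmxA.
set c := 2^-1 * _.
have -> : B^T *m P *m B *m (B^T *m P *m B) + c *: (B^T *m P *m B) =
    B^T *m (P *m R *m P + c *: P) *m B.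
  by rewrite RE mulmxDr mulmxDl -scalemxAr -scalemxAl !mulmxA.
rewrite -pdE; split=> -[pP eqP]; split=> //; first by rewrite eqP.
by apply: (can_inj (mulKmx uBT)); apply: (can_inj (mulmxK uB)).
Qed.

(* The eigenvalue of R Q belonging to the eigenvalue p i of R P. *)
Definition event_eigenvalue p (i : 'I_n) : K :=
  p i ^+ 2 + 2^-1 * (\sum_j p j) * p i.

(* The performance ratio in terms of the eigenvalues p of R P. *)
Definition ratio_of p : K := 1 + 2 * (\sum_i p i ^+ 2) / (\sum_i p i) ^+ 2.

(** Here [B] is chosen to diagonalize [P], not [Q]: the equation writes the transformed [Q] as a
    polynomial in the transformed [P], so it becomes diagonal too. *)
Lemma event_solution_spectrum R Q P : posdef R -> event_solution R Q P ->
  exists p, [/\ forall i, 0 < p i,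
    \tr (R *m P) = \sum_i p i,
    \tr (R *m Q) = \sum_i event_eigenvalue p i &
    char_poly (R *m Q) = \prod_(i < n) ('X - (event_eigenvalue p i)%:P)].
Proof.
move=> pR sP; have [pP _] := sP.
have [B [d [uB RE PE]]] := simultaneous_diag pR pP.1.
have trE N : \tr (R *m N) = \tr (B^T *m N *m B).
  by rewrite RE [RHS]mxtrace_mulC mulmxA.
have := (event_solution_congr Q P uB RE).1 sP.
rewrite /event_solution PE mul1mx mulmx1 mulmx_diag mxtrace_diag.
move=> [/posdef_diagP d0 eqQ].
pose p i := d 0 i.
have QE : B^T *m Q *m B = diag_mx (\row_i event_eigenvalue p i).
  by rewrite -eqQ -linearZ -linearD /=; congr diag_mx; apply/rowP => i; rewrite !mxE.
exists p; split=> //.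
- by rewrite trE PE mxtrace_diag.
- by rewrite trE QE mxtrace_diag; apply: eq_bigr => i _; rewrite mxE.
have -> : R *m Q = B *m (B^T *m Q *m B) *m invmx B.
  by rewrite !mulmxA mulmxK // RE.
rewrite char_poly_similar // QE char_poly_trig; last exact: diag_mx_is_trig.
by apply: eq_bigr => i _; rewrite !mxE eqxx.
Qed.

(** Now [B] diagonalizes [Q]; the scalar solution gives a diagonal matrix that is transported back
    by congruence. *)
Lemma event_solution_exists R Q : posdef R -> posdef Q ->
  exists P, event_solution R Q P.
Proof.
move=> pR pQ; have [B [d [uB RE QE]]] := simultaneous_diag pR pQ.1.
have /posdef_diagP d0 : posdef (diag_mx d) by rewrite -QE; exact: posdef_congr.
have [p [p0 pE]] := event_scalar_exists d0.
have uBT : B^T \in unitmx by rewrite unitmx_tr.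
exists (invmx B^T *m diag_mx (\row_i p i) *m invmx B).
apply/(event_solution_congr _ _ uB RE).
rewrite !mulmxA mulmxV // mul1mx mulmxKV // QE; split.
  by apply/posdef_diagP => i; rewrite mxE.
rewrite mulmx1 mul1mx mulmx_diag mxtrace_diag -linearZ -linearD /=.
congr diag_mx; apply/rowP => i; rewrite !mxE -pE.
by under eq_bigr do rewrite mxE; rewrite expr2.
Qed.

(** The traces are compared first. Once they agree, both matrices solve the same quadratic equation
    with a fixed scalar coefficient, and [posdef_root_unique] applies. *)
Lemma event_solution_unique R Q P P' : posdef R ->
  event_solution R Q P -> event_solution R Q P' -> P = P'.
Proof.
move=> pR sP sP'.
have [p [p0 trP _ chP]] := event_solution_spectrum pR sP.
have [q [q0 trP' _ chP']] := event_solution_spectrum pR sP'.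
have [s pq] := prod_XsubC_perm (etrans (esym chP) chP').
have trPP' : \tr (R *m P) = \tr (R *m P').
  rewrite trP trP' [RHS](reindex_inj (@perm_inj _ s)) /=.
  apply: event_scalar_unique => // i; rewrite [LHS]pq /event_eigenvalue.
  by rewrite [in LHS](reindex_inj (@perm_inj _ s)).
(* Only the factorization of [R] is wanted, so the second matrix is an arbitrary symmetric one. *)
have [B [d [uB RE _]]] := simultaneous_diag pR pR.1.
have uBT : B^T \in unitmx by rewrite unitmx_tr.
have trE N : \tr (R *m N) = \tr (B^T *m N *m B).
  by rewrite RE [RHS]mxtrace_mulC mulmxA.
have := (event_solution_congr Q P uB RE).1 sP.
have := (event_solution_congr Q P' uB RE).1 sP'.
rewrite /event_solution !mul1mx !mulmx1 -!trE -trPP' => -[pB' eB'] [pB eB].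
have t0 : 0 <= 2^-1 * \tr (R *m P).
  by rewrite mulr_ge0 ?invr_ge0 // trP; apply: sumr_ge0 => i _; exact: ltW.
have BPB := posdef_root_unique t0 pB pB' (etrans eB (esym eB')).
by apply: (can_inj (mulKmx uBT)); apply: (can_inj (mulmxK uB)).
Qed.

Lemma event_mx_solution R Q : posdef R -> posdef Q ->
  event_solution R Q (event_mx R Q).
Proof. by move=> pR pQ; apply: xgetPex; exact: event_solution_exists. Qed.

Context (n_gt0 : (0 < n)%N).

Lemma sum_pos p : (forall i, 0 < p i) -> 0 < \sum_i p i.
Proof.
move=> p0; rewrite (bigD1 (Ordinal n_gt0)) //= ltr_wpDr //.
by apply: sumr_ge0 => i _; exact: ltW.
Qed.

(** With [s] the sum of the [p i], summing the eigenvalues gives [\tr (R *m Q) = \sum_i p i ^+ 2 + s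
    ^+ 2 / 2], while [Je] is [s ^+ 2 / 4]. *)
Lemma ratio_spectrum R Q : posdef R -> posdef Q ->
  exists p, [/\ forall i, 0 < p i,
    Jp R Q / Je R Q = ratio_of p &
    char_poly (R *m Q) = \prod_(i < n) ('X - (event_eigenvalue p i)%:P)].
Proof.
move=> pR pQ.
have [p [p0 trP trQ chQ]] := event_solution_spectrum pR (event_mx_solution pR pQ).
exists p; split=> //; rewrite /ratio_of /Jp /Je trP trQ /event_eigenvalue big_split /=.
rewrite -mulr_sumr; have := sum_pos p0; move: (\sum_i p i) => s s0.
by field; rewrite gt_eqF.
Qed.

End EventSolution.

(** * Bounds on the ratio *)

Section Bounds.
Context (K : realType) (n : nat) (n_gt0 : (0 < n)%N).
Implicit Types (R Q : 'M[K]_n) (p : 'I_n -> K).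

Lemma ratio_of_ge p : (forall i, 0 < p i) -> 1 + 2 / n%:R <= ratio_of p.
Proof.
move=> p0; rewrite lerD2l -!mulrA ler_pM2l //.
have s0 := sum_pos n_gt0 p0.
have n0 : 0 < n%:R :> K by rewrite ltr0n.
rewrite ler_pdivlMr ?exprn_gt0 //.
have sqE c : \sum_i (p i - c) ^+ 2 =
    \sum_i p i ^+ 2 - 2 * c * (\sum_i p i) + n%:R * c ^+ 2.
  have -> : n%:R * c ^+ 2 = \sum_(i < n) c ^+ 2.
    by rewrite sumr_const card_ord mulr_natl.
  rewrite mulr_sumr -sumrB -big_split; apply: eq_bigr => i _ /=; ring.
(* Cauchy-Schwarz in the form of a nonnegative variance about the mean. *)
have : 0 <= \sum_i (p i - (\sum_i p i) / n%:R) ^+ 2.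
  by apply: sumr_ge0 => i _; exact: sqr_ge0.
rewrite sqE; move: (\sum_i p i) (\sum_i _) => s q.
have -> : q - 2 * (s / n%:R) * s + n%:R * (s / n%:R) ^+ 2 = q - n%:R^-1 * s ^+ 2.
  by field; rewrite gt_eqF.
by rewrite subr_ge0.
Qed.

Lemma ratio_of_lt3 p : (2 <= n)%N -> (forall i, 0 < p i) -> ratio_of p < 3.
Proof.
move=> n2 p0; have s0 := sum_pos n_gt0 p0.
suff h : \sum_i p i ^+ 2 < (\sum_i p i) ^+ 2.
  have h1 : (\sum_i p i ^+ 2) / (\sum_i p i) ^+ 2 < 1.
    by rewrite ltr_pdivrMr ?exprn_gt0 // mul1r.
  by rewrite /ratio_of -mulrA; lra.
pose i0 := Ordinal n_gt0; pose i1 := Ordinal n2.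
have sE : \sum_i p i = p i0 + \sum_(i | i != i0) p i by rewrite (bigD1 i0).
(* The second index [i1] makes this remainder positive, which is the source of the strict
   inequality. *)
have b0 : 0 < \sum_(i | i != i0) p i.
  rewrite (bigD1 i1) //= ltr_wpDr //.
  by apply: sumr_ge0 => i _; exact: ltW.
have c0 : \sum_(i | i != i0) p i ^+ 2 <= (\sum_(i | i != i0) p i) * \sum_i p i.
  rewrite mulr_suml; apply: ler_sum => i _; rewrite expr2 ler_pM2l //.
  rewrite (bigD1 i) //= lerDl; apply: sumr_ge0 => j _; exact: ltW.
by rewrite (bigD1 i0) //=; have := p0 i0; nra.
Qed.

(** A quantitative form of the limit: when one eigenvalue dominates the sum of the others, the gap
    to 3 must be small. *)
Lemma ratio_of_ge_eigen p i0 : (forall i, 0 < p i) ->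
  (3 - ratio_of p) * event_eigenvalue p i0 <=
    12 * \sum_(i | i != i0) event_eigenvalue p i.
Proof.
move=> p0; have s0 := sum_pos n_gt0 p0.
rewrite /ratio_of /event_eigenvalue big_split /= -mulr_sumr.
rewrite (bigD1 i0) //=.
have sE : \sum_i p i = p i0 + \sum_(i | i != i0) p i by rewrite (bigD1 i0).
have b0 : 0 <= \sum_(i | i != i0) p i by apply: sumr_ge0 => i _; exact: ltW.
have c0 : 0 <= \sum_(i | i != i0) p i ^+ 2 by apply: sumr_ge0 => i _; exact: sqr_ge0.
have a0 := p0 i0.
move: (p i0) (\sum_i p i) (\sum_(i | i != i0) p i) (\sum_(i | i != i0) p i ^+ 2)
  sE s0 a0 b0 c0 => a s b c -> s0 a0 b0 c0.
set t := a + b in s0 *.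
have -> : 3 - (1 + 2 * (a ^+ 2 + c) / t ^+ 2) =
    2 * (t ^+ 2 - a ^+ 2 - c) / t ^+ 2 by field; rewrite gt_eqF.
rewrite mulrAC ler_pdivrMr ?exprn_gt0 //.
have h1 : t ^+ 2 - a ^+ 2 - c <= 2 * b * t by rewrite /t; nra.
have h2 : a ^+ 2 + 2^-1 * t * a <= 3 / 2 * t ^+ 2 by rewrite /t; nra.
have h3 : 0 <= a ^+ 2 + 2^-1 * t * a by rewrite addr_ge0 ?sqr_ge0 ?mulr_ge0 // ltW.
have h4 : 2 * (t ^+ 2 - a ^+ 2 - c) * (a ^+ 2 + 2^-1 * t * a) <=
          2 * (2 * b * t) * (a ^+ 2 + 2^-1 * t * a).
  by rewrite ler_wpM2r // ler_pM2l.
have h5 : 2 * (2 * b * t) * (a ^+ 2 + 2^-1 * t * a) <=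
          2 * (2 * b * t) * (3 / 2 * t ^+ 2).
  by rewrite ler_wpM2l // !mulr_ge0 // ltW.
apply: le_trans h4 (le_trans h5 _).
(* The factor [2^-1 * t * b] is the linear part of the sum of the other eigenvalues; dropping their
   squares [c] leaves the constant 12. *)
have -> : 2 * (2 * b * t) * (3 / 2 * t ^+ 2) = 12 * (2^-1 * t * b) * t ^+ 2 by field.
rewrite ler_wpM2r ?sqr_ge0 // ler_pM2l // lerDr //.
Qed.

Lemma ratio_of_const p : (forall i, 0 < p i) -> (forall i j, p i = p j) ->
  ratio_of p = 1 + 2 / n%:R.
Proof.
move=> p0 pE.
rewrite /ratio_of; under eq_bigr do rewrite (pE _ (Ordinal n_gt0)).
under [X in _ / X ^+ 2]eq_bigr do rewrite (pE _ (Ordinal n_gt0)).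
rewrite !sumr_const card_ord -[_ *+ n]mulr_natr -[_ (Ordinal _) *+ n]mulr_natr.
have n0 : n%:R != 0 :> K by rewrite pnatr_eq0 -lt0n.
by have := p0 (Ordinal n_gt0); move: (p _) => b b0; field; rewrite n0 gt_eqF.
Qed.

(** With the sum [s] fixed, the difference of the two values factors as
    [(a - b) * (a + b + 2^-1 * s)], whose second factor is positive. *)
Lemma event_eigenvalue_inj p i j : (forall i, 0 < p i) ->
  event_eigenvalue p i = event_eigenvalue p j -> p i = p j.
Proof.
move=> p0; have := sum_pos n_gt0 p0; rewrite /event_eigenvalue.
have := p0 i; have := p0 j; move: (p i) (p j) (\sum_k p k) => a b s b0 a0 s0 h.
have /eqP : (a - b) * (a + b + 2^-1 * s) = 0.
  by rewrite -[RHS](subrr (b ^+ 2 + 2^-1 * s * b)) -{1}h; ring.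
rewrite mulf_eq0 subr_eq0 => /orP[/eqP//|].
by rewrite gt_eqF // !addr_gt0 // mulr_gt0.
Qed.

Lemma event_eigenvalue_gt0 p i : (forall i, 0 < p i) -> 0 < event_eigenvalue p i.
Proof.
move=> p0; rewrite addr_gt0 ?exprn_gt0 // !mulr_gt0 //; exact: sum_pos.
Qed.

(** The [p] of [ratio_spectrum] is reordered to follow the given list [e]; the ratio and the sum are
    symmetric in [p], so they do not change. *)
Lemma ratio_complex_spectrum R Q (e : 'I_n -> K[i]) :
  posdef R -> posdef Q -> is_spectrum (R *m Q) e ->
  exists p, [/\ forall i, 0 < p i, Jp R Q / Je R Q = ratio_of p &
    forall i, e i = real_complex K (event_eigenvalue p i)].
Proof.
move=> pR pQ; rewrite /is_spectrum /toC -map_char_poly.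
have [p [p0 -> ->]] := ratio_spectrum n_gt0 pR pQ.
rewrite map_prod_XsubC => /esym/prod_XsubC_perm[s sE].
have sumE (f : 'I_n -> K) : \sum_i f (s i) = \sum_i f i.
  by rewrite [RHS](reindex_inj (@perm_inj _ s)).
exists (p \o s); split=> [i||i]; first exact: p0.
  by rewrite /ratio_of /= (sumE (fun i => p i ^+ 2)) sumE.
by rewrite sE /event_eigenvalue /= sumE.
Qed.

End Bounds.

(** * Integrator systems: positivity of R and Q, and examples *)

Section Integrators.
Context (K : realType) (n : nat).

Lemma gram_posdef (m : nat) (C : 'M[K]_(m, n)) :
  (forall x : 'cV[K]_n, C *m x = 0 -> x = 0) -> posdef (C^T *m C).
Proof.
move=> injC; split=> [|x x0]; first by rewrite trmx_mul trmxK.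
have -> : x^T *m (C^T *m C) *m x = (C *m x)^T *m ((C *m x)^T)^T.
  by rewrite trmxK trmx_mul !mulmxA.
rewrite lt_neqAle row_sqr_sum sumr_ge0 ?andbT; last by move=> *; exact: sqr_ge0.
rewrite -row_sqr_sum eq_sym; apply: contra_neq x0 => /row_sqr_eq0 Cx.
by apply: injC; apply: trmx_inj; rewrite Cx trmx0.
Qed.

Lemma freq_mx00 : freq_mx (0 : 'M[K]_n) 0 = toC 0.
Proof. by apply/matrixP => i j; rewrite !mxE mul0rn subr0. Qed.

(** A vector [x] killed by [(Bw G)^T] would give the left null vector [row_mx x^T 0] of the second
    frequency matrix at 0. The first matrix is treated in the same way after transposition. *)
Lemma integrator_posdef (G : lti K n) (X Y : 'M[K]_n) : lqg_integrator G X Y ->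
  posdef (noise_intensity G Y) /\ posdef (state_cost G X).
Proof.
move=> [[_ _ _ /(_ 0) rkz /(_ 0) rky] A0 [_ ricX _] [_ ricY _]]; split.
  move: ricY; rewrite A0 trmx0 mul0mx mulmx0 !add0r => /eqP.
  rewrite subr_eq0 => /eqP <-; rewrite -{1}[Bw G]trmxK; apply: gram_posdef => x Bx.
  (* At frequency 0 the block matrix is real, and its rank is the same over [K] and [K[i]]. *)
  move: rky; rewrite A0 freq_mx00 /toC -map_block_mx mxrank_map => rky.
  have /row_free_inj inj : row_free (block_mx 0 (Bw G) (Cy G) (Dyw G)).
    by rewrite /row_free rky.
  have : row_mx x^T 0 = 0 :> 'rV_(n + dim_y G).
    apply: inj; rewrite mul0mx mul_row_block !mul0mx mulmx0 !addr0.
    by rewrite -[Bw G]trmxK -trmx_mul Bx trmx0 row_mx0.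
  by rewrite -row_mx0 => /eq_row_mx[xT _]; apply: trmx_inj; rewrite xT trmx0.
move: ricX; rewrite A0 trmx0 mul0mx mulmx0 !add0r => /eqP.
rewrite subr_eq0 => /eqP <-; apply: gram_posdef => x Cx.
move: rkz; rewrite A0 freq_mx00 /toC -map_block_mx mxrank_map -mxrank_tr => rkz.
have /row_free_inj inj : row_free (block_mx 0 (Bu G) (Cz G) (Dzu G))^T.
  by rewrite /row_free rkz.
have : row_mx x^T 0 = 0 :> 'rV_(n + dim_u G).
  apply: inj; rewrite mul0mx tr_block_mx mul_row_block !mul0mx trmx0 mulmx0 !addr0.
  by rewrite -trmx_mul Cx trmx0 row_mx0.
by rewrite -row_mx0 => /eq_row_mx[xT _]; apply: trmx_inj; rewrite xT trmx0.
Qed.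

Lemma hurwitz_opp_diag (c : 'rV[K]_n) : (forall i, 0 < c 0 i) ->
  hurwitz (- diag_mx c).
Proof.
move=> c0 l /eigenvalueP[v vl v0].
have [j vj] : exists j, v 0 j != 0.
  apply/existsP; apply: contraNT v0; rewrite negb_exists => /forallP h.
  by apply/eqP/rowP => j; rewrite mxE; apply/eqP; move: (h j); rewrite negbK.
have : - real_complex K (c 0 j) * v 0 j = l * v 0 j.
  move/matrixP: vl => /(_ 0 j); rewrite [in RHS]mxE => <-.
  rewrite /toC map_mxN map_diag_mx mulmxN mul_mx_diag !mxE mulNr mulrC //.
by move/(mulIf vj) => <-; rewrite raddfN /= oppr_lt0.
Qed.

(* Bw = [1 0], Dyw = [0 1], Cz = [diag c; 0], Dzu = [0; 1], Bu = Cy = 1, so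
   that X = diag c and Y = 1. *)
Lemma integrator_example (c : 'rV[K]_n) : (forall i, 0 < c 0 i) ->
  exists (G : lti K n) (X Y : 'M[K]_n), lqg_integrator G X Y /\
    is_spectrum (noise_intensity G Y *m state_cost G X)
      (fun i => real_complex K (c 0 i ^+ 2)).
Proof.
move=> c0.
pose D := diag_mx c.
have uD : D \in unitmx by apply/posdef_unitmx/posdef_diagP.
have hN1 : hurwitz (- 1%:M : 'M[K]_n).
  by rewrite -diag_const_mx; apply: hurwitz_opp_diag => i; rewrite mxE.
pose G : lti K n := @Lti K n (n + n) n (n + n) n 0 (row_mx 1%:M 0) 1%:M
  (col_mx D 0) (col_mx 0 1%:M) 1%:M (row_mx 0 1%:M).
have DD : (Dzu G)^T *m Dzu G = 1%:M.
  by rewrite /= tr_col_mx mul_row_col !trmx0 !trmx1 mul0mx add0r mulmx1.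
have EE : Dyw G *m (Dyw G)^T = 1%:M.
  by rewrite /= tr_row_mx mul_row_col !trmx0 !trmx1 mul0mx add0r mulmx1.
have FE : gainF G D = - D.
  rewrite /gainF DD invmx1 mul1mx /= tr_col_mx mul_row_col !trmx0 trmx1.
  by rewrite !mul1mx ?mul0mx ?mulmx0 !addr0.
have LE : gainL G 1%:M = - 1%:M.
  rewrite /gainL EE invmx1 mulmx1 /= tr_row_mx mul_row_col !trmx0 !trmx1.
  by rewrite !mulmx1 ?mul0mx ?mulmx0 !addr0.
have QE : state_cost G D = D *m D.
  rewrite /state_cost DD FE mulmx1.
  have -> : (- D)^T = - D by rewrite linearN /= tr_diag_mx.
  by rewrite mulmxN mulNmx opprK.
have RE : noise_intensity G 1%:M = 1%:M.
  rewrite /noise_intensity EE LE mulmx1.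
  have -> : (- 1%:M : 'M[K]_n)^T = - 1%:M by rewrite linearN /= trmx1.
  by rewrite mulmxN mulNmx opprK mulmx1.
exists G, D, 1%:M; split; last first.
  rewrite RE QE mul1mx mulmx_diag /is_spectrum /toC -map_char_poly.
  rewrite char_poly_trig; last exact: diag_mx_is_trig.
  rewrite rmorph_prod; apply: eq_bigr => i _.
  by rewrite /= map_polyXsubC !mxE eqxx mulr1n -expr2.
split.
- split.
  + by split; [exists (- 1%:M)|exists (- 1%:M)]; rewrite /= add0r ?mul1mx ?mulmx1.
  + by rewrite /= rank_col_0mx mxrank1.
  + by rewrite /= rank_row_0mx mxrank1.
  + move=> w /=; apply/eqP; apply/row_fullP.
    (* This left inverse ignores the block row containing [w]: [Cz] and [Dzu] side by side already
       form an invertible matrix. *)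
    exists (block_mx 0 (row_mx (toC (invmx D)) 0) 0 (row_mx 0 1%:M)).
    rewrite mulmx_block /toC !map_col_mx !map_mx0 !map_mx1.
    rewrite !mul_row_col !mul0mx !mulmx0 !mul1mx !add0r !addr0.
    by rewrite -map_mxM mulVmx // map_mx1 -scalar_mx_block.
  + move=> w /=; apply/eqP; apply/row_freeP.
    (* Dually, [Bw] stacked on [Dyw] is the identity, so the block column containing [w] gets weight
       0. *)
    exists (block_mx 0 0 (col_mx 1%:M 0) (col_mx 0 1%:M)).
    rewrite mulmx_block /toC !map_row_mx !map_mx0 !map_mx1.
    rewrite !mul_row_col !mul0mx !mulmx0 !mul1mx !add0r !addr0.
    by rewrite -scalar_mx_block.
- by [].
- split; first exact: tr_diag_mx.
  + rewrite QE /= trmx0 mul0mx mulmx0 !add0r tr_col_mx mul_row_col trmx0 mul0mx.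
    by rewrite addr0 tr_diag_mx subrr.
  + by rewrite FE /= add0r mul1mx; exact: hurwitz_opp_diag.
- split; first exact: trmx1.
  + rewrite RE /= mulmx1 trmx0 mulmx0 !add0r tr_row_mx mul_row_col trmx0 mulmx0.
    by rewrite addr0 trmx1 mulmx1 subrr.
  + by rewrite LE /= add0r mulmx1.
Qed.

End Integrators.

(** * Limits and the final assembly *)

Lemma cvg_sum0 (K : realType) (n : nat) (P : pred 'I_n) (f : nat -> 'I_n -> K) :
  (forall i, P i -> f k i @[k --> \oo] --> (0 : K)) ->
  (\sum_(i < n | P i) f k i) @[k --> \oo] --> (0 : K).
Proof.
move=> f0.
have /= := @cvg_big K _ +%R 0 P _ nat \oo (index_enum 'I_n) (fun i k => f k i) (fun=> 0).
by rewrite big1 //; apply => //; exact: add_continuous.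
Qed.

Theorem theorem5 (K : realType) (n : nat) (n_gt0 : (0 < n)%N) :
  (forall (G : lti K n) (X Y : 'M[K]_n), lqg_integrator G X Y ->
     [/\ exists! P : 'M[K]_n,
           event_solution (noise_intensity G Y) (state_cost G X) P,
         (2 <= n)%N -> 1 + 2 / n%:R <= Jratio G X Y < 3 &
         n = 1%N -> Jratio G X Y = 3])
  /\
  ((2 <= n)%N ->
    [/\ forall (G : lti K n) (X Y : 'M[K]_n) (e : 'I_n -> K[i]),
          lqg_integrator G X Y ->
          is_spectrum (noise_intensity G Y *m state_cost G X) e ->
          (forall i j : 'I_n, e i = e j) ->
          Jratio G X Y = 1 + 2 / n%:R,
        forall (G : nat -> lti K n) (X Y : nat -> 'M[K]_n)
               (e : nat -> 'I_n -> K[i]) (i0 : 'I_n),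
          (forall k : nat, lqg_integrator (G k) (X k) (Y k)) ->
          (forall k : nat, is_spectrum (noise_intensity (G k) (Y k) *m state_cost (G k) (X k)) (e k)) ->
          (forall i : 'I_n, i != i0 -> Normc.normc (e k i) @[k --> \oo] --> (0 : K)) ->
          (exists2 c : K, 0 < c & forall k : nat, c <= Normc.normc (e k i0)) ->
          Jratio (G k) (X k) (Y k) @[k --> \oo] --> (3 : K),
        exists (G : lti K n) (X Y : 'M[K]_n),
          lqg_integrator G X Y /\ Jratio G X Y = 1 + 2 / n%:R &
        forall eps : K, 0 < eps ->
          exists (G : lti K n) (X Y : 'M[K]_n),
            lqg_integrator G X Y /\ 3 - eps < Jratio G X Y]).
Proof.
split=> [G X Y lqgG|n2].
  have [pR pQ] := integrator_posdef lqgG.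
  have [p [p0 JE _]] := ratio_spectrum n_gt0 pR pQ.
  rewrite /Jratio JE.
  split=> [|n2|n1].
  - exists (event_mx (noise_intensity G Y) (state_cost G X)).
    split=> [|P]; first exact: event_mx_solution.
    by apply: event_solution_unique => //; exact: event_mx_solution.
  - by rewrite ratio_of_ge // ratio_of_lt3.
  - rewrite ratio_of_const // => [|i j].
      by rewrite n1; field.
    (* For [n = 1] all indices coincide, so [p] is constant and the ratio is 1 + 2/1. *)
    have val0 (k : 'I_n) : val k = 0%N.
      by apply/eqP; rewrite -leqn0 -ltnS -[X in (_ < X)%N]n1 ltn_ord.
    by congr p; apply/val_inj; rewrite !val0.
(* This explicit bound serves both the squeeze argument for sequences and the choice of a system for
   a given [eps]. *)
have lower (G : lti K n) (X Y : 'M[K]_n) (e : 'I_n -> K[i]) i0 c :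
    lqg_integrator G X Y ->
    is_spectrum (noise_intensity G Y *m state_cost G X) e ->
    0 < c -> c <= Normc.normc (e i0) ->
    3 - 12 / c * \sum_(i | i != i0) Normc.normc (e i) <= Jratio G X Y < 3.
  move=> /integrator_posdef[pR pQ] eRQ c0.
  have [p [p0 JE eE]] := ratio_complex_spectrum n_gt0 pR pQ eRQ.
  have normE i : Normc.normc (e i) = event_eigenvalue p i.
    rewrite eE /= expr0n /= addr0 sqrtr_sqr ger0_norm // ltW //.
    exact: event_eigenvalue_gt0.
  under eq_bigr do rewrite normE.
  rewrite normE /Jratio JE ratio_of_lt3 // andbT => ci0.
  have := ratio_of_ge_eigen n_gt0 i0 p0.
  have := ratio_of_lt3 n_gt0 n2 p0; rewrite -subr_gt0 => J3 h.
  have {}h := le_trans (ler_wpM2l (ltW J3) ci0) h.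
  by rewrite lerBlDr -lerBlDl mulrAC ler_pdivlMr.
have equal (G : lti K n) (X Y : 'M[K]_n) (e : 'I_n -> K[i]) :
    lqg_integrator G X Y ->
    is_spectrum (noise_intensity G Y *m state_cost G X) e ->
    (forall i j : 'I_n, e i = e j) -> Jratio G X Y = 1 + 2 / n%:R.
  move=> /integrator_posdef[pR pQ] eRQ eE.
  have [p [p0 JE epE]] := ratio_complex_spectrum n_gt0 pR pQ eRQ.
  rewrite /Jratio JE; apply: ratio_of_const => // i j.
  apply: (event_eigenvalue_inj n_gt0) => //; apply: (@complexI K).
  by rewrite -!epE.
split; first exact: equal.
- move=> G X Y e i0 lqgG eRQ e0 [c c0 ce].
  apply: (@squeeze_cvgr _ _ _ _
    (fun k => 3 - 12 / c * \sum_(i | i != i0) Normc.normc (e k i)) (fun=> 3)).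
  + apply: nearW => k.
    by have /andP[-> /ltW ->] := lower _ _ _ _ i0 c (lqgG k) (eRQ k) c0 (ce k).
  + rewrite -[X in _ --> X]subr0; apply: cvgB; first exact: cvg_cst.
    rewrite -[X in _ --> X](mulr0 (12 / c)); apply: cvgMr.
    exact: (cvg_sum0 (f := fun k i => Normc.normc (e k i))).
  + exact: cvg_cst.
- have [i|G [X [Y [lqgG eRQ]]]] := @integrator_example K n (const_mx 1).
    by rewrite mxE.
  by exists G, X, Y; split=> //; apply: (equal _ _ _ _ lqgG eRQ) => i j; rewrite !mxE.
- move=> eps eps0; pose i0 := Ordinal n_gt0.
  have nK : 0 < n%:R :> K by rewrite ltr0n.
  (* The eigenvalues are 1 at [i0] and [d2] elsewhere. Those elsewhere add up to at most [eps / 24],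
     so by [lower] with [c = 1] the gap is at most [eps / 2]. The square root below compensates for
     the spectrum being the squares of the entries of [c]. *)
  pose d2 := eps / (24 * n%:R).
  have d2_gt0 : 0 < d2 by rewrite divr_gt0 // mulr_gt0.
  pose c : 'rV[K]_n := \row_i (if i == i0 then 1 else Num.sqrt d2).
  have [i|G [X [Y [lqgG eRQ]]]] := @integrator_example K n c.
    by rewrite mxE; case: ifP => // _; rewrite sqrtr_gt0.
  exists G, X, Y; split; first exact: lqgG.
  have normE i : Normc.normc (real_complex K (c 0 i ^+ 2)) = c 0 i ^+ 2.
    by rewrite /= expr0n /= addr0 sqrtr_sqr ger0_norm // sqr_ge0.
  have c1 : 1 <= Normc.normc (real_complex K (c 0 i0 ^+ 2)).
    by rewrite normE mxE eqxx expr1n.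
  have /andP[+ _] := lower _ _ _ _ i0 1 lqgG eRQ ltr01 c1.
  apply: lt_le_trans; rewrite ltrD2l ltrN2 divr1.
  have sumle : \sum_(i | i != i0) Normc.normc (real_complex K (c 0 i ^+ 2)) <=
      n%:R * d2.
    apply: (@le_trans _ _ (\sum_(i < n) d2)).
      rewrite [leRHS](bigD1 i0) // ler_wpDl ?(ltW d2_gt0) //.
      apply: ler_sum => i i0i; rewrite normE mxE (negbTE i0i).
      by rewrite sqr_sqrtr // ltW.
    by rewrite sumr_const card_ord mulr_natl.
  have nd2 : n%:R * d2 = eps / 24 by rewrite /d2; field; rewrite gt_eqF.
  by rewrite nd2 in sumle; lra.
Qed.
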